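(* Let $f:[0,1]\to[0,1]$ be a symmetric unimodal map with $f(\tfrac12)=1$, and let $\varphi:[0,1]\to[0,1]$ be the increasing symmetric Lorenz map obtained from $f$. If $\varphi$ has a periodic point of prime period $n$, then for every positive integer $m\neq 1$ with $m\prec n$ in the Sharkovsky order, $\varphi$ has a periodic point of prime period $m$.
   Context: A symmetric unimodal map is a continuous map $f:[0,1]\to[0,1]$ that is strictly increasing on $[0,c]$ and strictly decreasing on $[c,1]$, where $c=\tfrac12$, with $f(1-x)=f(x)$ for all $x$, and scaled so that $f(c)=1$. (It is not required that $f(0)=0$.) Write $\tilde x=1-x$. The increasing symmetric Lorenz map obtained from $f$ is $\varphi(x)=f(x)$ for $x\in[0,c]$ and $\varphi(x)=1-f(x)$ for $x\in(c,1]$. A point $x$ has prime period $n$ for a map $g$ if $g^n(x)=x$ and $g^k(x)\neq x$ for $1\le k<n$. The Sharkovsky order on the positive integers is $$1\prec 2\prec 4\prec 8\prec\dots\prec 4\cdot 7\prec 4\cdot 5\prec 4\cdot 3\prec\dots\prec 2\cdot 7\prec 2\cdot 5\prec 2\cdot 3\prec\dots\prec 7\prec 5\prec 3.$$ *)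

(* Defs.v *)
From mathcomp Require Import all_boot all_order all_algebra.
From mathcomp Require Import all_classical all_reals all_analysis.

Set Implicit Arguments.
Unset Strict Implicit.
Unset Printing Implicit Defensive.

Import Order.TTheory GRing.Theory Num.Theory.
Import numFieldNormedType.Exports.

Local Open Scope ring_scope.
Local Open Scope classical_set_scope.

(* A self-map of [0, 1] is represented by a total function on R of which only
   the values on [0, 1] are constrained or used. *)
Record symmetric_unimodal (R : realType) (f : R -> R) : Prop := {
  unimodal_maps : forall x : R, 0 <= x <= 1 -> 0 <= f x <= 1;
  unimodal_cont : {within `[0, 1], continuous f};
  unimodal_incr : forall x y : R, 0 <= x -> x < y -> y <= 2^-1 -> f x < f y;
  unimodal_decr : forall x y : R, 2^-1 <= x -> x < y -> y <= 1 -> f y < f x;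
  unimodal_sym : forall x : R, 0 <= x <= 1 -> f (1 - x) = f x;
  unimodal_top : f 2^-1 = 1
}.

Definition lorenz (R : realType) (f : R -> R) (x : R) : R :=
  if x <= 2^-1 then f x else 1 - f x.

Definition prime_period (T : Type) (g : T -> T) (n : nat) (x : T) : Prop :=
  [/\ (0 < n)%N, iter n g x = x
    & forall k : nat, (1 <= k < n)%N -> iter k g x <> x].

Definition has_prime_period (R : realType) (g : R -> R) (n : nat) : Prop :=
  exists x : R, 0 <= x <= 1 /\ prime_period g n x.

(* [sharkovsky m n] is the strict relation "m precedes n" in
   1, 2, 4, 8, ..., 4*7, 4*5, 4*3, ..., 2*7, 2*5, 2*3, ..., 7, 5, 3. *)
Inductive sharkovsky : nat -> nat -> Prop :=
| sharkovsky_pow2 (i j : nat) :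
    (i < j)%N -> sharkovsky (2 ^ i) (2 ^ j)
| sharkovsky_pow2_odd (i j q : nat) :
    odd q -> (1 < q)%N -> sharkovsky (2 ^ i) (2 ^ j * q)
| sharkovsky_exponent (i j p q : nat) :
    odd p -> (1 < p)%N -> odd q -> (1 < q)%N ->
    (j < i)%N -> sharkovsky (2 ^ i * p) (2 ^ j * q)
| sharkovsky_odd_part (i p q : nat) :
    odd p -> odd q -> (1 < q)%N ->
    (q < p)%N -> sharkovsky (2 ^ i * p) (2 ^ i * q).

(* Main.v *)
Require Import Defs.
From mathcomp Require Import all_boot all_order all_algebra.
From mathcomp Require Import all_classical all_reals all_analysis.
From mathcomp Require Import zify lra.

Set Implicit Arguments.
Unset Strict Implicit.
Unset Printing Implicit Defensive.

(** Write phi for [lorenz f].  Code a point by L or R (here [false] or [true])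
    according to the side of 1/2 on which it lies.  Since phi is increasing on
    both sides of 1/2, points are ordered as their itineraries are ordered
    lexicographically, and the reflection x |-> 1 - x, which commutes with phi
    away from 1/2, complements itineraries.  Since phi jumps from 1 to 0 at 1/2,
    the only constraint on an itinerary is that none of its shifts be too large
    or too small.  Hence a single periodic orbit, together with its reflection,
    forces every periodic word b such that each shift of b or of its complement
    is strictly below some shift of the itinerary a of that orbit or of its
    complement; this is the relation [dominated b a].

    Realization of dominated words ([exists_clamped], [dominated_coded],
    [dominated_lt1]).  Each branch of phi has an increasing inverse, extended by
    a constant to all of [0, 1].  Following these inverses backwards along b
    always produces a periodic sequence of points, by a greatest fixed point.
    Domination traps these points between points of the given orbit and of its
    reflection, so the constant extensions are never used, and keeps them
    strictly between 0 and 1, so that 1/2 is never met with the wrong code: the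
    sequence is an orbit of phi.

    Combinatorics ([dominated_exists]).  It remains to find, for m before n in
    the Sharkovsky order and m > 1, a word of least period m dominated by a
    given word a of least period n.  Call i a defect of a when a has the same
    letter at i and i + 1.
    - If two defects are an odd distance apart, then some two consecutive
      defects have an odd gap g, and up to complement a contains the word
      RR LR LR ... L RR.  This already dominates the words RR LR ... LR LL of
      every even length, and the words RR LR ... LR L of every odd length
      exceeding g ([spike_dominated]).  When n is odd a defect recurs at distance
      n, so there is an odd gap at most n, which covers all m before n.  When n
      is even only even m precede n.
    - Otherwise all defects have the same parity, n is even, and a shift of a
      is obtained from a word a' of least period n/2 by the substitution
      L -> LR, R -> RL.  This substitution preserves the lexicographic order
      and domination ([dominated_doubling]), and halving m and n is compatible
      with the Sharkovsky order ([sharkovsky_step]), so induction on n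
      applies.  On the dynamical side this is period doubling. *)

(** * The lexicographic order on itineraries *)

(** When a is the itinerary of an orbit, these are the itineraries of its points
    (e = false) and of their reflections (e = true). *)
Definition view (e : bool) (s : nat) (a : nat -> bool) (i : nat) : bool :=
  e (+) a (s + i).

Definition lexlt (x y : nat -> bool) : Prop :=
  exists d, [/\ forall i, (i < d)%N -> x i = y i, x d = false & y d = true].

Definition dominated (b a : nat -> bool) : Prop :=
  forall e s, exists e' t, lexlt (view e s b) (view e' t a).

Definition least_period (n : nat) (a : nat -> bool) : Prop :=
  [/\ (0 < n)%N, forall i, a (i + n) = a i
    & forall k, (0 < k < n)%N -> exists i, a (i + k) != a i].

(** RR is the largest beginning, so a shift that does not begin with RR is below
    every shift that does; this settles most comparisons. *)
Lemma lexlt_RR (x y : nat -> bool) :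
  ~~ (x 0 && x 1) -> y 0 -> y 1 -> lexlt x y.
Proof.
case x0: (x 0) => /= x1 y0 y1; last by exists 0.
exists 1; split=> //; last exact/negbTE.
by case=> // _; rewrite x0 y0.
Qed.

Lemma lexlt_ext (x x' y y' : nat -> bool) :
  x =1 x' -> y =1 y' -> lexlt x y -> lexlt x' y'.
Proof.
move=> ex ey [d [xy xd yd]]; exists d; rewrite -ex -ey; split=> // i id.
by rewrite -ex -ey xy.
Qed.

Lemma lexlt_cons (x y : nat -> bool) :
  x 0 = y 0 -> lexlt (x \o S) (y \o S) -> lexlt x y.
Proof.
move=> xy0 [d [xy xd yd]]; exists d.+1; split=> // -[//|i] id.
exact: xy.
Qed.

Lemma least_period_mul (n k i : nat) (a : nat -> bool) :
  least_period n a -> a (i + k * n) = a i.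
Proof.
case=> _ an _; elim: k => [|k IH]; first by rewrite addn0.
by rewrite mulSn addnCA addnC an IH.
Qed.

Lemma least_period_switch (n : nat) (a : nat -> bool) : (1 < n)%N ->
  least_period n a -> exists i, a i.+1 = ~~ a i.
Proof.
move=> n1 [_ _ /(_ 1)] [//|i]; rewrite addn1 => ai; exists i.
by move: ai; case: (a i.+1); case: (a i).
Qed.

Lemma least_period_takes (n : nat) (a : nat -> bool) (v : bool) : (1 < n)%N ->
  least_period n a -> exists i, a i = v.
Proof.
move=> n1 /(least_period_switch n1)[i ai]; have [aiv|aiv] := eqVneq (a i) v.
  by exists i.
by exists i.+1; rewrite ai; move: aiv; case: (a i); case: v.
Qed.

(** Prepending R to a word that dominates a word x beginning with R does not lose
    the domination, so one may move back along a run of R's until an L is met. *)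
Lemma lexlt_run (r k : nat) (a x : nat -> bool) : a r = false -> x 0 ->
  lexlt x (fun i => a ((r + k).+1 + i)) ->
  exists t, a t = false /\ lexlt x (fun i => a (t.+1 + i)).
Proof.
move=> ar x0; elim: k => [|k IH]; first by rewrite addn0; exists r.
rewrite addnS; case ak: (a (r + k).+1); last by exists (r + k).+1.
move=> [d [xy xd yd]]; apply: IH.
have exL : exists l, ~~ x l by exists d; rewrite xd.
case: (ex_minnP exL) => l xl lmin.
have ld : (l <= d)%N by apply: lmin; rewrite xd.
have l0 : (0 < l)%N by case: l xl {lmin ld} => //; rewrite x0.
have xR i : (i < l)%N -> x i.
  by apply: contraTT => xi; rewrite -leqNgt lmin.
have yR i : (i <= l)%N -> a ((r + k).+1 + i).
  case: i => [|i] il; first by rewrite addn0.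
  by rewrite -addSnnS -xy ?xR//; lia.
exists l; split; [|exact/negbTE|exact: yR].
by move=> i il; rewrite xR// yR// ltnW.
Qed.

(** * Words with an odd gap between defects *)

(** If the last element before k is at an odd position, descend to it; otherwise
    it is at an odd distance from k. *)
Lemma odd_gap (d : nat -> bool) (k : nat) : d 0 -> d k -> odd k ->
  exists i g, [/\ odd g, (i + g <= k)%N, d i, d (i + g)
                & forall l, (0 < l < g)%N -> ~~ d (i + l)].
Proof.
move=> d0; elim/ltn_ind: k => k IH dk ok.
have kpos : (0 < k)%N by case: k ok {IH dk}.
pose P := fun j => (j < k)%N && d j.
have exP : exists j, P j by exists 0; rewrite /P kpos d0.
have ubP j : P j -> (j <= k)%N by case/andP=> /ltnW.
case: (ex_maxnP exP ubP) => j /andP[jk dj] jmax.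
have [oj|ej] := boolP (odd j).
  have [i [g [og ig di dig nd]]] := IH j jk dj oj.
  by exists i, g; split=> //; lia.
exists j, (k - j); rewrite subnKC ?(ltnW jk)//; split=> //.
  by rewrite oddB ?(ltnW jk)// ok (negbTE ej).
move=> l /andP[l0 lk]; apply/negP => dl.
have /jmax : P (j + l) by rewrite /P dl andbT; lia.
lia.
Qed.

(** The periodic word RR LR LR ... of length m.  The last letter is L, also when
    m is even, where the word is RR LR ... LR LL. *)
Definition spike (m i : nat) : bool :=
  let r := i %% m in (r == 0) || odd r && (r.+1 != m).

Lemma spikeD (m i : nat) : spike m (i + m) = spike m i.
Proof. by rewrite /spike modnDr. Qed.

Lemma spike_small (m i : nat) : (i < m)%N ->
  spike m i = (i == 0) || odd i && (i.+1 != m).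
Proof. by move=> im; rewrite /spike modn_small. Qed.

(** For m > 2 the block RR occurs only once per period. *)
Lemma spike_least_period (m : nat) : (1 < m)%N -> least_period m (spike m).
Proof.
move=> m1; split=> [|i|k /andP[k0 km]]; first lia; first exact: spikeD.
have [sk|sk] := boolP (spike m k); last first.
  by exists 0; rewrite add0n (negbTE sk) spike_small// (ltnW m1).
exists 1; move: sk; rewrite add1n spike_small// => sk.
rewrite !spike_small//; lia.
Qed.

(** Only the shifts of the word and of its complement beginning with RR have to be
    compared with the block RR LR ... L RR of a.  These are the word itself, and,
    for even m, the complement started at its block LL. *)
Lemma spike_dominated (m g t : nat) (e : bool) (a : nat -> bool) :
  (1 < m)%N -> odd g -> (odd m -> (g < m)%N) ->
  view e t a 0 -> (forall k, (0 < k <= g)%N -> view e t a k = odd k) ->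
  view e t a g.+1 -> dominated (spike m) a.
Proof.
move=> m1 og gm; set y := view e t a => y0 yk yg e' s; exists e, t.
rewrite -/y.
have g0 : (0 < g)%N by case: g og {gm yk yg}.
have y1 : y 1 by rewrite yk.
have [|] := boolP (view e' s (spike m) 0 && view e' s (spike m) 1); last first.
  by move=> nRR; exact: lexlt_RR.
have viewE i : view e' s (spike m) i = e' (+) spike m (s %% m + i).
  by rewrite /view /spike modnDml.
rewrite !viewE addn0.
have : (s %% m < m)%N by rewrite ltn_mod; lia.
case: e' viewE; move: (s %% m) => r viewE rm; rewrite addn1.
- (* The complement begins with RR where the word has LL, at m - 2 with m even;
     the next RR of the word makes it continue with LL. *)
  rewrite /= => v; have [rm2 om m4] : [/\ r = m - 2, ~~ odd m & (3 < m)%N].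
    move: v; rewrite (@spike_small m r)//; have [r1m|r1m] := eqVneq r.+1 m.
      by rewrite [spike _ r.+1]/spike r1m modnn andbF.
    rewrite spike_small; last lia.
    by move=> v; split; lia.
  have v2 : view true s (spike m) 2 = false.
    by rewrite viewE rm2 subnK// ?/spike ?modnn//; lia.
  have v3 : view true s (spike m) 3 = false.
    rewrite viewE rm2 (_ : m - 2 + 3 = 1 + m); last lia.
    by rewrite spikeD spike_small//; lia.
  have [v0 v1] : view true s (spike m) 0 /\ view true s (spike m) 1.
    by rewrite !viewE addn0 addn1; case/andP: v.
  have [g1|g3] := eqVneq g 1.
    exists 2; split=> //; last by rewrite -g1 in yg *.
    by case=> [|[|]]// _; rewrite ?v0 ?v1 ?y0 ?y1.
  exists 3; split=> //; last by rewrite yk//; lia.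
  case=> [|[|[|]]]// _; rewrite ?v0 ?v1 ?v2 ?y0 ?y1//.
  by rewrite yk//; lia.
- (* RR occurs in the word only at multiples of m.  The comparison with a is
     settled where the gap of a ends, or at the final LL if this comes first. *)
  rewrite /= => v; have r0 : r = 0.
    move: v; rewrite (@spike_small m r)//; case/andP.
    by case: (eqVneq r 0) => //= r0 /andP[or r1m]; rewrite spike_small; lia.
  have {viewE}viewE i : (i < m)%N ->
      view false s (spike m) i = (i == 0) || odd i && (i.+1 != m).
    by move=> im; rewrite viewE r0 add0n spike_small.
  have [gm1|mg] := ltnP g.+1 m.
    exists g.+1; split=> //; last by rewrite viewE//=; lia.
    case=> [|i] ig; first by rewrite viewE ?y0//; lia.
    by rewrite viewE ?yk; lia.
  exists m.-1; split; last by rewrite yk; lia.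
    case=> [|i] ig; first by rewrite viewE ?y0//; lia.
    by rewrite viewE ?yk; lia.
  by rewrite viewE; lia.
Qed.

(** Between consecutive defects the letters alternate, which turns an odd gap
    into the block RR LR ... L RR up to complement. *)
Lemma spike_dominated_defects (m k i : nat) (a : nat -> bool) :
  (1 < m)%N -> odd k -> (odd m -> (k < m)%N) ->
  a i.+1 = a i -> a (i + k).+1 = a (i + k) -> dominated (spike m) a.
Proof.
move=> m1 ok km ai aik.
pose d l := a (i + l).+1 == a (i + l).
have [||//|j [g [og jgk dj djg nd]]] := @odd_gap d k.
- by rewrite /d addn0 ai.
- by rewrite /d aik.
pose e := ~~ a (i + j).
have g0 : (0 < g)%N by case: g og {jgk djg nd}.
have y0 : view e (i + j) a 0 by rewrite /view addn0 /e; case: (a _).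
have yk l : (0 < l <= g)%N -> view e (i + j) a l = odd l.
  elim: l => [//|[|l] IH] /andP[_ lg].
    by rewrite /view addn1 (eqP dj) -[RHS]y0 /view addn0.
  have := nd l.+1; rewrite /d => /(_ lg); rewrite addnA => dl.
  rewrite oddS -IH; last exact: ltnW.
  by rewrite /view addnS; move: dl; case: (a _); case: (a _); case: (e).
apply: (@spike_dominated m g (i + j) e) => //.
  by move=> om; apply: leq_ltn_trans (km om); lia.
rewrite /view addnS -addnA (eqP djg) addnA.
by have := yk g; rewrite g0 leqnn /view => ->.
Qed.

(** * The period-doubling substitution *)

(** The image of a under L -> LR, R -> RL. *)
Definition doubling (a : nat -> bool) (i : nat) : bool := odd i (+) a i./2.

Lemma doubling_even (a : nat -> bool) (i : nat) : doubling a i.*2 = a i.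
Proof. by rewrite /doubling odd_double doubleK. Qed.

Lemma doubling_odd (a : nat -> bool) (i : nat) : doubling a i.*2.+1 = ~~ a i.
Proof. by rewrite /doubling oddS odd_double /= uphalf_double. Qed.

Lemma parity_ind (P : nat -> Prop) :
  (forall i, P i.*2) -> (forall i, P i.*2.+1) -> forall i, P i.
Proof.
move=> Pe Po i; rewrite -(odd_double_half i); move: (i./2) => j.
by case: (odd i); [exact: Po | exact: Pe].
Qed.

Lemma lexlt_doubling (x y : nat -> bool) :
  lexlt x y -> lexlt (doubling x) (doubling y).
Proof.
case=> d [xy xd yd]; exists d.*2; rewrite !doubling_even; split=> // i id.
by rewrite /doubling xy//; lia.
Qed.

Lemma doubling_view (e : bool) (s : nat) (a : nat -> bool) :
  doubling (view e s a) =1 view e s.*2 (doubling a).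
Proof.
apply: parity_ind => i; rewrite /view ?addnS -doubleD.
  by rewrite !doubling_even.
by rewrite !doubling_odd addbN.
Qed.

Lemma doubling_least_period (m : nat) (a : nat -> bool) : (1 < m)%N ->
  least_period m a -> least_period m.*2 (doubling a).
Proof.
move=> m1 [m0 am prim]; split; first by rewrite double_gt0.
  by apply: parity_ind => i; rewrite ?addSn -doubleD ?doubling_even ?doubling_odd am.
apply: parity_ind => k /andP[k0 km].
  have [|i ai] := prim k; first lia.
  by exists i.*2; rewrite -doubleD !doubling_even.
apply: contrapT => nex.
have eqk i : doubling a (i + k.*2.+1) = doubling a i.
  by apply: contrapT => ne; apply: nex; exists i; apply/eqP.
have even_eq i : a (i + k) = ~~ a i.
  by have := eqk i.*2; rewrite addnS -doubleD doubling_odd doubling_even => <-; rewrite negbK.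
have odd_eq i : a (i + k).+1 = ~~ a i.
  have := eqk i.*2.+1; rewrite addSnnS -doubleS -doubleD doubling_even doubling_odd.
  by rewrite addnS.
have [//|i] := prim 1.
rewrite addn1 => /eqP; apply; apply: negb_inj.
by rewrite -even_eq -odd_eq addSn.
Qed.

(** Even shifts of a doubled word are doublings of shifts.  An odd shift that
    begins with RR is R followed by the doubling of a shift x beginning with R.
    To bound it by an odd shift of [doubling a], the shift of a above x has to be
    preceded by L, and [lexlt_run] provides one that is. *)
Lemma dominated_doubling (n : nat) (a b : nat -> bool) : (1 < n)%N ->
  least_period n a -> dominated b a -> dominated (doubling b) (doubling a).
Proof.
move=> n1 an ba e; apply: parity_ind => s.
  have [e' [t lt_ab]] := ba e s; exists e', t.*2.
  by apply: lexlt_ext (lexlt_doubling lt_ab); exact: doubling_view.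
have [|notRR] :=
  boolP (view e s.*2.+1 (doubling b) 0 && view e s.*2.+1 (doubling b) 1); last first.
  have [i ai] := least_period_switch n1 an.
  exists (a i), i.*2.+1; apply: lexlt_RR => //; rewrite /view ?addn0 ?addn1.
    by rewrite doubling_odd; case: (a i).
  by rewrite -doubleS doubling_even ai; case: (a i).
rewrite {1 2}/view addn0 addn1 doubling_odd -doubleS doubling_even.
move=> /andP[z0 z1]; have [e' [t lt_ab]] := ba e s.+1.
have [r0 ar0] := least_period_takes e' n1 an.
(* Adding periods to t puts the L at r0 in front of it. *)
have [k rkE] : exists k, (r0 + k).+1 = t + r0.+1 * n.
  by exists (t + r0.+1 * n - r0.+1); nia.
have [t' [at' lt']] : exists t', view e' 0 a t' = false /\
    lexlt (view e s.+1 b) (fun i => view e' 0 a (t'.+1 + i)).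
  apply: (@lexlt_run r0 k); first by rewrite /view add0n ar0; case: (e').
    by rewrite /view addn0.
  apply: lexlt_ext lt_ab => // i; rewrite rkE /view add0n addnAC.
  by rewrite (least_period_mul _ _ an).
exists e', t'.*2.+1; apply: lexlt_cons.
  rewrite /view !addn0 !doubling_odd z0.
  by move: at'; rewrite /view add0n addbN => ->.
apply: lexlt_ext (lexlt_doubling lt') => i.
  by rewrite doubling_view /view /= doubleS addSnnS.
have -> : (fun i => view e' 0 a (t'.+1 + i)) = view e' t'.+1 a.
  by apply: funext => j; rewrite /view add0n.
by rewrite doubling_view /view /= doubleS addSnnS.
Qed.

(** A smaller period of a' would double to a smaller period of a from s on,
    and hence everywhere, since a is periodic. *)
Lemma least_period_half (n s : nat) (a a' : nat -> bool) :
  least_period n.*2 a -> doubling a' =1 view false s a -> least_period n a'.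
Proof.
move=> an aa'; have [n2 _ prim] := an.
have n0 : (0 < n)%N by lia.
split=> // [i|k /andP[k0 kn]].
  by rewrite -!(doubling_even a') !aa' /view doubleD addnA; case: an => _ ->.
have [|i ai] := prim k.*2; first lia.
have [j jE] : exists j, s + j = i + s * n.*2 by exists (i + s * n.*2 - s); nia.
exists j./2; move: ai; apply: contra => /eqP a'j.
rewrite -(least_period_mul s (i + _) an) addnAC -jE -addnA.
rewrite -(least_period_mul s i an) -jE; apply/eqP.
have := aa' (j + k.*2); have := aa' j; rewrite /view !addFb => <- <-.
rewrite /doubling oddD odd_double addbF; congr addb.
by rewrite halfD odd_double andbF doubleK.
Qed.

(** * Words dominated by a given periodic word *)

(** The one fact about the order that the induction on n uses: an even n has, apart
    from 1, only even predecessors, and these come from the predecessors of n/2. *)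
Lemma sharkovsky_step (m n : nat) : sharkovsky m n -> m <> 1 ->
  (odd n /\ (1 < n)%N /\ (odd m -> (n < m)%N))
  \/ (exists m1 n1, [/\ m = m1.*2, n = n1.*2, (1 < n1)%N & sharkovsky m1 n1]).
Proof.
have half i k : 2 ^ i.+1 * k = (2 ^ i * k).*2 by rewrite expnS -mulnA mul2n.
have big i q : (1 < q)%N -> (1 < 2 ^ i * q)%N.
  by move=> q1; rewrite (leq_trans q1)// leq_pmull ?expn_gt0.
case=> [i j|i j q oq q1|i j p q op p1 oq q1|i p q op oq q1 ltqp].
- case: i => [//|i]; case: j => [//|j] ij _; right.
  exists (2 ^ i), (2 ^ j); rewrite !expnS !mul2n; split=> //; last first.
    exact: sharkovsky_pow2.
  by rewrite -{1}(expn0 2) ltn_exp2l //; lia.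
- case: i => [//|i] _; case: j => [|j].
    by left; rewrite mul1n; split=> //; split=> //; rewrite expnS oddM.
  right; exists (2 ^ i), (2 ^ j * q); rewrite expnS mul2n half; split=> //.
    exact: big.
  exact: sharkovsky_pow2_odd.
- case: i => [//|i] ij _; case: j ij => [|j] ij.
    by left; rewrite mul1n; split=> //; split=> //; rewrite half odd_double.
  right; exists (2 ^ i * p), (2 ^ j * q); rewrite !half; split=> //.
    exact: big.
  exact: sharkovsky_exponent.
- case: i => [|i] _; first by left; rewrite !mul1n; split=> //; split.
  right; exists (2 ^ i * p), (2 ^ i * q); rewrite !half; split=> //.
    exact: big.
  exact: sharkovsky_odd_part.
Qed.

Theorem dominated_exists (m n : nat) (a : nat -> bool) :
  sharkovsky m n -> (0 < m)%N -> m <> 1 -> least_period n a ->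
  exists2 b, least_period m b & dominated b a.
Proof.
elim/ltn_ind: n m a => n IH m a smn m0 mN1 an.
have m1 : (1 < m)%N by lia.
have n2 : (2 < n)%N.
  case: (sharkovsky_step smn mN1) => [[on [n1 _]]|[m1' [n1 [_ -> n1_gt1 _]]]].
    by case: n on n1 {IH smn an} => [|[|[|]]].
  by lia.
(* Without a defect a alternates and has period 2 < n. *)
have [i ai] : exists i, a i.+1 = a i.
  apply: contrapT => nex.
  have alt i : a i.+1 = ~~ a i.
    have : a i.+1 <> a i by move=> ai; apply: nex; exists i.
    by case: (a _); case: (a _).
  case: an => _ _ /(_ 2) [//|i]; rewrite addn2 !alt negbK eqxx//.
have spikeP k : odd k -> (odd m -> (k < m)%N) -> a (i + k).+1 = a (i + k) ->
    exists2 b, least_period m b & dominated b a.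
  move=> ok km aik; exists (spike m); first exact: spike_least_period.
  exact: spike_dominated_defects aik.
case: (sharkovsky_step smn mN1) => [[on [n1 mn]]|[m' [n' [mE nE n1 smn']]]].
  by case: an (an) => _ an _ _; apply: (spikeP n); rewrite -?addSn ?an.
have [[k [ok aik]]|nok] := pselect (exists k, odd k /\ a (i + k).+1 = a (i + k)).
  by apply: (spikeP k) => //; rewrite mE odd_double.
(* All defects are at even distance from i, so the pairs that start at odd
   distance are LR or RL. *)
pose a' l := a (i.+1 + l.*2).
have aa' : doubling a' =1 view false i.+1 a.
  apply: parity_ind => l; rewrite ?doubling_even ?doubling_odd /a' /view addFb//.
  have : a (i + l.*2.+1).+1 <> a (i + l.*2.+1).
    by move=> al; apply: nok; exists l.*2.+1; rewrite /= odd_double.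
  by rewrite !addSn !addnS; case: (a _); case: (a _).
have an' : least_period n' a' by apply: least_period_half aa'; rewrite -nE.
have dom_a b' : dominated b' a' -> dominated (doubling b') a.
  move=> /(dominated_doubling n1 an') dom e s; have [e' [t lt]] := dom e s.
  exists e', (i.+1 + t); apply: lexlt_ext lt => // l.
  by rewrite /view aa' /view addFb addnA.
(* The alternating word has no RR, while the defect i puts RR in a or in its
   complement. *)
have [m'1|m'N1] := eqVneq m' 1.
  exists (spike m); first exact: spike_least_period.
  move=> e s; exists (~~ a i), i; apply: lexlt_RR.
  - rewrite mE m'1 /view addn0 addn1 /spike !modn2 oddS.
    by case: (odd s); case: e.
  - by rewrite /view addn0; case: (a i).
  - by rewrite /view addn1 ai; case: (a i).
have [||||b' b'm domb] := IH n' _ m' a' smn' => //; first lia.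
  lia.
  exact/eqP.
exists (doubling b'); last exact: dom_a.
by rewrite mE; apply: doubling_least_period => //; lia.
Qed.

(** * The two branches and their inverses *)

Import Order.TTheory GRing.Theory Num.Theory.
Import numFieldNormedType.Exports.
Local Open Scope ring_scope.
Local Open Scope classical_set_scope.

Definition branch (R : realType) (f : R -> R) (b : bool) (x : R) : R :=
  if b then 1 - f x else f x.

Definition side (R : realType) (b : bool) (x : R) : bool :=
  if b then 2^-1 <= x else x <= 2^-1.

Definition flip (R : realType) (e : bool) (x : R) : R := if e then 1 - x else x.

(** The default value 0 is the one that is wanted for y < f 0: it extends the
    inverse of the left branch to a nondecreasing function below f 0. *)
Definition left_inv (R : realType) (f : R -> R) (y : R) : R :=
  xget 0 [set x | 0 <= x <= 2^-1 /\ f x = y].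

(** The right branch is the reflection of the left one. *)
Definition inv_branch (R : realType) (f : R -> R) (b : bool) (y : R) : R :=
  flip b (left_inv f (flip b y)).

Lemma flip_bounds (R : realType) (e : bool) (x : R) :
  0 <= x <= 1 -> 0 <= flip e x <= 1.
Proof. by rewrite /flip; case: e => //; lra. Qed.

Lemma side_flip (R : realType) (e b : bool) (x : R) :
  side (e (+) b) (flip e x) = side b x.
Proof. by rewrite /side /flip; case: e; case: b => //=; apply/idP/idP; lra. Qed.

Lemma unimodal_le (R : realType) (f : R -> R) (x y : R) :
  symmetric_unimodal f -> 0 <= x -> x <= y -> y <= 2^-1 -> f x <= f y.
Proof.
move=> hf x0; rewrite le_eqVlt => /orP[/eqP-> //|xy] y1.
exact/ltW/(unimodal_incr hf).
Qed.

Lemma unimodal_min (R : realType) (f : R -> R) (x : R) :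
  symmetric_unimodal f -> 0 <= x <= 1 -> f 0 <= f x.
Proof.
move=> hf x01; have [x2|x2] := leP x 2^-1.
  by apply: (unimodal_le hf) => //; lra.
by rewrite -[f x](unimodal_sym hf)//; apply: (unimodal_le hf); lra.
Qed.

Lemma left_inv_bounds (R : realType) (f : R -> R) (y : R) :
  0 <= left_inv f y <= 2^-1.
Proof.
rewrite /left_inv; case: xgetP => [x _ [? _]//|_]; lra.
Qed.

Lemma left_invK (R : realType) (f : R -> R) (y : R) :
  symmetric_unimodal f -> f 0 <= y <= 1 -> f (left_inv f y) = y.
Proof.
move=> hf /andP[fy y1]; rewrite /left_inv; case: xgetP => [x _ [_ ->//]|].
have f01 : f 0 <= f 2^-1 by rewrite (unimodal_top hf); lra.
have cf : {within `[0, 2^-1], continuous f}.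
  move: (unimodal_cont hf); apply: continuous_subspaceW.
  by move=> x /=; rewrite !in_itv /=; lra.
have := @IVT R f 0 2^-1 y _ cf.
rewrite min_l// max_r// (unimodal_top hf) => /(_ ltac:(lra) ltac:(lra)) [c].
by rewrite in_itv /= => c02 fc /(_ c) [].
Qed.

Lemma left_inv_out (R : realType) (f : R -> R) (y : R) :
  symmetric_unimodal f -> y < f 0 -> left_inv f y = 0.
Proof.
move=> hf yf; rewrite /left_inv; case: xgetP => [x _ [x01 fx]|//].
by have := unimodal_min hf (_ : 0 <= x <= 1); rewrite fx => /(_ ltac:(lra)); lra.
Qed.

Lemma left_inv_le (R : realType) (f : R -> R) (y z : R) :
  symmetric_unimodal f -> y <= z -> z <= 1 -> left_inv f y <= left_inv f z.
Proof.
move=> hf yz z1; have [yf|fy] := ltP y (f 0).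
  by rewrite (left_inv_out hf yf); have := left_inv_bounds f z; lra.
have := left_inv_bounds f y; have := left_inv_bounds f z => zb yb.
rewrite leNgt; apply/negP => lt.
have := unimodal_incr hf _ lt _; rewrite !(left_invK hf); lra.
Qed.

Lemma inv_branch_bounds (R : realType) (f : R -> R) (b : bool) (y : R) :
  0 <= inv_branch f b y <= 1 /\ side b (inv_branch f b y).
Proof.
by rewrite /inv_branch /side /flip; case: b; have := left_inv_bounds f; [move=> /(_ (1 - y))|move=> /(_ y)]; lra.
Qed.

Lemma inv_branch_le (R : realType) (f : R -> R) (b : bool) (y z : R) :
  symmetric_unimodal f -> 0 <= y -> y <= z -> z <= 1 ->
  inv_branch f b y <= inv_branch f b z.
Proof.
move=> hf y0 yz z1; rewrite /inv_branch /flip; case: b; last exact: left_inv_le.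
by rewrite lerB// (left_inv_le hf)//; lra.
Qed.

Lemma branchK (R : realType) (f : R -> R) (b : bool) (x : R) :
  symmetric_unimodal f -> 0 <= x <= 1 -> side b x ->
  inv_branch f b (branch f b x) = x.
Proof.
have main y : symmetric_unimodal f -> 0 <= y <= 2^-1 -> left_inv f (f y) = y.
  move=> hf y01; have fy := unimodal_maps hf (_ : 0 <= y <= 1).
  have lb := left_inv_bounds f (f y).
  have eqf : f (left_inv f (f y)) = f y.
    by rewrite (left_invK hf)// (unimodal_min hf); lra.
  apply/eqP; rewrite eq_le !leNgt; apply/andP; split; apply/negP => lt.
    by have := unimodal_incr hf _ lt _; lra.
  by have := unimodal_incr hf _ lt _; lra.
move=> hf x01; rewrite /side /inv_branch /branch /flip; case: b => xs.
  by rewrite subKr -(unimodal_sym hf)// main ?subKr//; lra.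
by rewrite main//; lra.
Qed.

Lemma branch_flip (R : realType) (f : R -> R) (e b : bool) (x : R) :
  symmetric_unimodal f -> 0 <= x <= 1 ->
  branch f (e (+) b) (flip e x) = flip e (branch f b x).
Proof.
by move=> hf x01; rewrite /branch /flip; case: e; case: b => //=;
  rewrite (unimodal_sym hf)// subKr.
Qed.

Lemma branch_lt (R : realType) (f : R -> R) (b : bool) (x y : R) :
  symmetric_unimodal f -> 0 <= x <= 1 -> 0 <= y <= 1 ->
  side b x -> side b y -> x < y -> branch f b x < branch f b y.
Proof.
move=> hf x01 y01; rewrite /side /branch; case: b => xs ys xy.
  by rewrite ltrD2l ltrN2 (unimodal_decr hf)//; lra.
by apply: (unimodal_incr hf) => //; lra.
Qed.

Lemma branch_le (R : realType) (f : R -> R) (b : bool) (x y : R) :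
  symmetric_unimodal f -> 0 <= x <= 1 -> 0 <= y <= 1 ->
  side b x -> side b y -> x <= y -> branch f b x <= branch f b y.
Proof.
move=> hf x01 y01 xs ys; rewrite le_eqVlt => /orP[/eqP->//|xy].
exact/ltW/branch_lt.
Qed.

(** * Sequences of points with a prescribed itinerary *)

(** A sequence that follows the branches prescribed by w.  The point 1/2 may carry
    either code, which makes the notion invariant under reflection; an orbit of
    phi is the case where 1/2 is always coded L. *)
Definition coded (R : realType) (f : R -> R) (w : nat -> bool) (x : nat -> R) :=
  forall i, [/\ 0 <= x i <= 1, side (w i) (x i)
              & x i.+1 = branch f (w i) (x i)].

(** As [coded], but following the extended inverse branches backwards, so that
    a point on which the inverse branch is constant need not be mapped forward. *)
Definition clamped (R : realType) (f : R -> R) (w : nat -> bool) (x : nat -> R) :=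
  forall i, 0 <= x i <= 1 /\ x i = inv_branch f (w i) (x i.+1).

Definition real_view (R : realType) (e : bool) (s : nat) (x : nat -> R) (i : nat) :=
  flip e (x (s + i)%N).

Lemma coded_clamped (R : realType) (f : R -> R) (w : nat -> bool) (x : nat -> R) :
  symmetric_unimodal f -> coded f w x -> clamped f w x.
Proof.
by move=> hf cx i; have [x01 xs ->] := cx i; split=> //; rewrite branchK.
Qed.

Lemma coded_view (R : realType) (f : R -> R) (e : bool) (s : nat)
    (w : nat -> bool) (x : nat -> R) :
  symmetric_unimodal f -> coded f w x -> coded f (view e s w) (real_view e s x).
Proof.
move=> hf cx i; have [x01 xs xE] := cx (s + i)%N; rewrite /real_view /view; split.
- exact: flip_bounds.
- by rewrite side_flip.
- by rewrite addnS xE branch_flip.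
Qed.

Lemma clamped_view (R : realType) (f : R -> R) (e : bool) (s : nat)
    (w : nat -> bool) (x : nat -> R) :
  clamped f w x -> clamped f (view e s w) (real_view e s x).
Proof.
move=> cx i; have [x01 xE] := cx (s + i)%N; rewrite /real_view /view; split.
  exact: flip_bounds.
rewrite addnS {1}xE /inv_branch /flip.
by case: e; case: (w _) => //=; rewrite !subKr.
Qed.

(** * Existence of a clamped sequence for every word *)

(** The post-fixed points of the monotone operator whose fixed points are the
    clamped sequences. *)
Definition subclamped (R : realType) (f : R -> R) (w : nat -> bool) (z : nat -> R) :=
  forall i, 0 <= z i <= 1 /\ z i <= inv_branch f (w i) (z i.+1).

Definition top_point (R : realType) (f : R -> R) (w : nat -> bool) : R :=
  sup [set z 0%N | z in subclamped f w].

Lemma has_sup_subclamped (R : realType) (f : R -> R) (w : nat -> bool) :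
  has_sup [set z 0%N | z in subclamped f w].
Proof.
split; last by exists 1 => _ [z sz <-]; case: (sz 0%N) => /andP[].
exists 0, (fun=> 0) => // i; split; first by lra.
by have [/andP[]] := inv_branch_bounds f (w i) 0.
Qed.

Lemma top_point_ub (R : realType) (f : R -> R) (w : nat -> bool) (z : nat -> R) :
  subclamped f w z -> z 0%N <= top_point f w.
Proof.
move=> sz; apply: sup_upper_bound; first exact: has_sup_subclamped.
by exists z.
Qed.

Lemma top_point_bounds (R : realType) (f : R -> R) (w : nat -> bool) :
  0 <= top_point f w <= 1.
Proof.
have [[_ [z sz _]] _] := has_sup_subclamped f w.
apply/andP; split.
  by apply: le_trans (top_point_ub sz); case: (sz 0%N) => /andP[].
apply: ge_sup; first by exists (z 0%N), z.
by move=> _ [z' sz' <-]; case: (sz' 0%N) => /andP[].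
Qed.

(** The argument of Knaster and Tarski. *)
Lemma top_point_fix (R : realType) (f : R -> R) (w : nat -> bool) :
  symmetric_unimodal f ->
  top_point f w = inv_branch f (w 0%N) (top_point f (w \o S)).
Proof.
move=> hf.
have le_fix v : top_point f v <= inv_branch f (v 0%N) (top_point f (v \o S)).
  apply: ge_sup; first by case: (has_sup_subclamped f v).
  move=> _ [z sz <-]; have [_ /le_trans] := sz 0%N; apply.
  have ub := @top_point_ub _ f (v \o S) (z \o S) (fun i => sz i.+1).
  apply: inv_branch_le => //; first by case: (sz 1%N) => /andP[].
  by have /andP[] := top_point_bounds f (v \o S).
apply/eqP; rewrite eq_le le_fix /=.
(* Improving the first entry of the best sequence keeps it post-fixed. *)
pose z i := if i is i'.+1 then top_point f (fun k => w (i + k)%N)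
  else inv_branch f (w 0%N) (top_point f (w \o S)).
apply: (@top_point_ub _ _ _ z) => -[|i] /=.
  by split=> //; have [] := inv_branch_bounds f (w 0%N) (top_point f (w \o S)).
split; first exact: top_point_bounds.
have -> : (fun k => w (i.+2 + k)%N) = (fun k => w (i.+1 + k)%N) \o S.
  by apply: funext => k /=; rewrite addnS.
by apply: le_trans (le_fix _) _; rewrite addn0.
Qed.

(** The greatest solution depends on the word alone, hence it inherits the periods
    of the word. *)
Lemma exists_clamped (R : realType) (f : R -> R) (w : nat -> bool) (m : nat) :
  symmetric_unimodal f -> (forall i, w (i + m)%N = w i) ->
  exists x, clamped f w x /\ forall i, x (i + m)%N = x i.
Proof.
move=> hf wm; exists (fun i => top_point f (fun k => w (i + k)%N)); split=> i.
  split; first exact: top_point_bounds.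
  rewrite top_point_fix// addn0; congr (inv_branch f _ (top_point f _)).
  by apply: funext => k /=; rewrite addnS.
by congr top_point; apply: funext => k; rewrite addnAC wm.
Qed.

(** * Lexicographic order and order of points *)

(** At the first place where the words differ the two points are on opposite
    sides of 1/2, and inverse branches carry the inequality back. *)
Lemma clamped_le (R : realType) (f : R -> R) (w u : nat -> bool) (x y : nat -> R) :
  symmetric_unimodal f -> clamped f w x -> clamped f u y -> lexlt w u ->
  x 0%N <= y 0%N.
Proof.
move=> hf cx cy [d [wu wd ud]].
suff le k : (k <= d)%N -> x (d - k)%N <= y (d - k)%N by have := le d; rewrite subnn; apply.
elim: k => [_|k IH kd].
  rewrite subn0; have [_ ->] := cx d; have [_ ->] := cy d; rewrite wd ud.
  have [_] := inv_branch_bounds f false (x d.+1).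
  have [_] := inv_branch_bounds f true (y d.+1).
  by rewrite /side; lra.
have [_ ->] := cx (d - k.+1)%N; have [_ ->] := cy (d - k.+1)%N.
rewrite wu ?subnSK//; last lia.
have [x01 _] := cx (d - k)%N; have [y01 _] := cy (d - k)%N.
by apply: inv_branch_le => //; [lra|apply: IH; lia|lra].
Qed.

(** As long as the codes agree, increasing branches would carry the opposite
    inequality forward from 0 to d. *)
Lemma coded_lt (R : realType) (f : R -> R) (w u : nat -> bool) (x y : nat -> R) (d : nat) :
  symmetric_unimodal f -> coded f w x -> coded f u y ->
  (forall i, (i < d)%N -> w i = u i) -> x d < y d -> x 0%N < y 0%N.
Proof.
move=> hf cx cy; elim: d => [//|d IH] wu; rewrite ltNge => lt.
apply: IH => [i id|]; first by apply: wu; rewrite ltnW.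
rewrite ltNge; apply: contra lt => yx.
have [x01 xs ->] := cx d; have [y01 ys ->] := cy d.
by move: xs ys; rewrite wu// => xs ys; rewrite branch_le.
Qed.

Lemma coded_lt_iter (R : realType) (f : R -> R) (w : nat -> bool) (x y : nat -> R) (k : nat) :
  symmetric_unimodal f -> coded f w x -> coded f w y ->
  x 0%N < y 0%N -> x k < y k.
Proof.
move=> hf cx cy xy; elim: k => [//|k IH].
have [x01 xs ->] := cx k; have [y01 ys ->] := cy k.
exact: branch_lt.
Qed.

(** Under the upper bound given by y, the point after an R is at most
    1 - f (y 0) <= 1 - f 0, hence in the range of the right branch, where the
    inverse branch is a true inverse. *)
Lemma clamped_forward (R : realType) (f : R -> R) (w u : nat -> bool) (x y : nat -> R) :
  symmetric_unimodal f -> clamped f w x -> coded f u y -> lexlt w u ->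
  w 0%N = true -> x 1%N = branch f true (x 0%N).
Proof.
move=> hf cx cy [d [wu wd ud]] w0.
have d0 : (0 < d)%N by case: d wd {wu ud} => //; rewrite w0.
have u0 : u 0%N = true by rewrite -wu.
have cy' := coded_clamped hf cy.
have x1 : x 1%N <= y 1%N.
  apply: (@clamped_le _ f (w \o S) (u \o S) (x \o S) (y \o S)) => //.
  - by move=> i; exact: cx.
  - by move=> i; exact: cy'.
  - exists d.-1; rewrite /= prednK//; split=> // i id.
    by apply: wu; lia.
have [y01 _] := cy 0%N; rewrite u0 /branch => y1.
have y0f := unimodal_min hf y01.
have [x01 x0] := cx 0%N; have [x101 _] := cx 1%N.
rewrite x0 w0 /inv_branch /flip (unimodal_sym hf) ?left_invK//; first by lra.
  by rewrite y1 in x1; lra.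
by have := left_inv_bounds f (1 - x 1%N); lra.
Qed.

(** Reflecting if necessary makes the code at i equal to R. *)
Lemma dominated_coded (R : realType) (f : R -> R) (a b : nat -> bool) (p x : nat -> R) :
  symmetric_unimodal f -> coded f a p -> clamped f b x -> dominated b a ->
  coded f b x.
Proof.
move=> hf cp cx dom i; have [x01 xE] := cx i; split=> //.
  by rewrite xE; have [] := inv_branch_bounds f (b i) (x i.+1).
have [e' [t lt]] := dom (~~ b i) i.
have bi : view (~~ b i) i b 0 = true by rewrite /view addn0; case: (b i).
have := clamped_forward hf (clamped_view (~~ b i) i cx) (coded_view e' t hf cp) lt bi.
rewrite -bi /view /real_view !addn0 addn1 branch_flip// /flip.
by case: (b i) => //=; lra.
Qed.

(** * Itineraries of periodic points *)

Lemma lorenz_coded (R : realType) (f : R -> R) (p : R) :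
  symmetric_unimodal f -> 0 <= p <= 1 ->
  coded f (fun i => 2^-1 < iter i (lorenz f) p) (fun i => iter i (lorenz f) p).
Proof.
move=> hf p01.
have maps y : 0 <= y <= 1 -> 0 <= lorenz f y <= 1.
  move=> y01; rewrite /lorenz; have := unimodal_maps hf y01.
  by case: ifP; lra.
have in01 i : 0 <= iter i (lorenz f) p <= 1.
  by elim: i => [//|i IH]; rewrite iterS maps.
move=> i; split=> //=; rewrite /side /branch /lorenz ltNge.
  by case: leP => //= /ltW.
by case: leP.
Qed.

Lemma lorenz_eq0 (R : realType) (f : R -> R) (y : R) :
  symmetric_unimodal f -> 0 <= y <= 1 -> lorenz f y = 0 -> y = 0.
Proof.
move=> hf y01; rewrite /lorenz; case: leP => y2 fy; last first.
  by have := unimodal_decr hf (lexx _) y2 _; rewrite (unimodal_top hf); lra.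
have [//|y0] := eqVneq y 0.
have ylt : 0 < y by rewrite lt0r y0; lra.
have := unimodal_incr hf (lexx _) ylt y2; rewrite fy.
by have := unimodal_maps hf (_ : 0 <= 0 <= 1); lra.
Qed.

Lemma iter_period_mul (T : Type) (g : T -> T) (n k i : nat) (x : T) :
  iter n g x = x -> iter (i + k * n) g x = iter i g x.
Proof.
move=> gn; elim: k => [|k IH]; first by rewrite addn0.
by rewrite mulSn addnCA addnC iterD gn.
Qed.

(** Only 0 can be mapped to 0 by phi, so a periodic orbit through 0 is a fixed
    point. *)
Lemma periodic_orbit_neq0 (R : realType) (f : R -> R) (n i : nat) (p : R) :
  symmetric_unimodal f -> 0 <= p <= 1 -> (1 < n)%N ->
  prime_period (lorenz f) n p -> iter i (lorenz f) p != 0.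
Proof.
move=> hf p01 n1 [n0 pn prim]; apply/eqP => pi0.
have back j : iter j.+1 (lorenz f) p = 0 -> iter j (lorenz f) p = 0.
  apply: lorenz_eq0 => //; by have [] := lorenz_coded hf p01 j.
have all0 j : iter j (lorenz f) p = 0.
  have : iter (i + j * n) (lorenz f) p = 0 by rewrite iter_period_mul.
  have -> : (i + j * n = (i + j * n.-1) + j)%N by nia.
  by elim: (i + j * n.-1)%N => [//|k IH] /back.
by apply: (prim 1%N); rewrite ?n1//= [LHS](all0 1%N) [RHS](all0 0%N).
Qed.

(** If p and its k-th iterate have the same itinerary, then the k-th iterate of
    phi moves p monotonically, and p can return only if it is fixed by it. *)
Lemma itinerary_least_period (R : realType) (f : R -> R) (n : nat) (p : R) :
  symmetric_unimodal f -> 0 <= p <= 1 -> prime_period (lorenz f) n p ->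
  least_period n (fun i => 2^-1 < iter i (lorenz f) p).
Proof.
move=> hf p01 [n0 pn prim]; split=> // [i|k kn]; first by rewrite iterD pn.
apply: contrapT => nex.
have eqk : view false k (fun i => 2^-1 < iter i (lorenz f) p) =
           (fun i => 2^-1 < iter i (lorenz f) p).
  apply: funext => i; rewrite /view addnC; apply: contrapT => ne.
  by apply: nex; exists i; apply/eqP.
have cp := lorenz_coded hf p01.
have cpk := coded_view false k hf cp; rewrite eqk in cpk.
have shiftE j : real_view false k (fun i => iter i (lorenz f) p) j =
  iter (k + j) (lorenz f) p by [].
have pnk : iter (n * k) (lorenz f) p = p by rewrite mulnC; exact: (iter_period_mul k 0 pn).
case: (ltgtP p (iter k (lorenz f) p)) => [lt|gt|pk]; last exact: (prim k kn).
- suff inc j : p < iter (j.+1 * k) (lorenz f) p.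
    by have := inc n.-1; rewrite prednK// pnk ltxx.
  elim: j => [|j IH]; first by rewrite mul1n.
  apply: (lt_trans IH).
  have := coded_lt_iter (j.+1 * k) hf cp cpk; rewrite !shiftE addn0 -mulSn; exact.
- suff dec j : iter (j.+1 * k) (lorenz f) p < p.
    by have := dec n.-1; rewrite prednK// pnk ltxx.
  elim: j => [|j IH]; first by rewrite mul1n.
  apply: lt_trans IH.
  have := coded_lt_iter (j.+1 * k) hf cpk cp; rewrite !shiftE addn0 -mulSn; exact.
Qed.

(** If the dominating point is a reflection 1 - p t, it is itself less than 1.
    If it is p t, a point coded R is strictly to the right of 1/2, which
    makes the comparison strict.  The case distinction is needed because p may
    pass through 1/2, and its reflection codes that point R. *)
Lemma dominated_lt1 (R : realType) (f : R -> R) (a b : nat -> bool) (p x : nat -> R)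
    (e : bool) (s : nat) :
  symmetric_unimodal f -> coded f a p -> coded f b x ->
  (forall i, a i = (2^-1 < p i)) -> (forall i, p i != 0) ->
  dominated b a -> flip e (x s) < 1.
Proof.
move=> hf cp cx ap p0 dom; have [e' [t lt]] := dom e s.
have cx' := coded_view e s hf cx; have cp' := coded_view e' t hf cp.
have -> : flip e (x s) = real_view e s x 0 by rewrite /real_view addn0.
have le := clamped_le hf (coded_clamped hf cx') (coded_clamped hf cp') lt.
case: e' lt cp' le => lt cp' le.
  apply: le_lt_trans le _; rewrite /real_view /flip addn0.
  have [/andP[pt _] _ _] := cp t; have : 0 < p t by rewrite lt0r p0.
  lra.
have [d [ba bd ad]] := lt.
apply: lt_le_trans (_ : real_view false t p 0 <= 1); last by have [/andP[]] := cp' 0%N.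
apply: (coded_lt hf cx' cp' ba).
have [_ + _] := cx' d; rewrite bd /side /real_view /=; move: ad.
rewrite /view /= ap; lra.
Qed.

Theorem theorem1 (R : realType) (f : R -> R) (n m : nat)
  (hf : symmetric_unimodal f)
  (hn : has_prime_period (lorenz f) n)
  (hm0 : (0 < m)%N) (hm1 : m <> 1%N) (hmn : sharkovsky m n) :
  has_prime_period (lorenz f) m.
Proof.
have n1 : (1 < n)%N by case: (sharkovsky_step hmn hm1) => [[_ []]|[m' [n' [_ ->]]]]; lia.
case: hn => p [p01 pn].
have [b bm dom] := dominated_exists hmn hm0 hm1 (itinerary_least_period hf p01 pn).
have cp := lorenz_coded hf p01.
have [bper prim] : (forall i, b (i + m)%N = b i) /\
    forall k, (0 < k < m)%N -> exists i, b (i + k)%N != b i by case: bm.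
have [x [clx xm]] := exists_clamped hf bper.
have cx := dominated_coded hf cp clx dom.
(* A point 1/2 coded R would be followed by 0. *)
have x_gt0 i : 0 < x i.
  have := @dominated_lt1 _ _ _ _ _ _ true i hf cp cx (fun=> erefl)
    (fun j => periodic_orbit_neq0 j hf p01 n1 pn) dom.
  by rewrite /flip; lra.
have right i : b i = (2^-1 < x i).
  have [_ + xS] := cx i; have := x_gt0 i.+1; rewrite xS /side /branch.
  case: (b i) => [|_]; last by case: ltP.
  move=> fx; rewrite le_eqVlt => /orP[/eqP x2|->//].
  by move: fx; rewrite -x2 (unimodal_top hf); lra.
have orbit i : iter i (lorenz f) (x 0%N) = x i.
  elim: i => [//|i IH]; rewrite iterS IH; have [_ _ ->] := cx i.
  by rewrite /lorenz /branch right; case: leP.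
exists (x 0%N); split; first by case: (cx 0%N).
split=> // [|k km]; first by rewrite orbit -(xm 0%N).
move=> xk; have [i /eqP] := prim k km; apply; rewrite !right.
by rewrite -(orbit (i + k)%N) -(orbit i) iterD xk.
Qed.
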